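(* Let $R$ be a semi-field, let $X$ be a set of measurements with a covering $\mathcal{U}=\{U_j\}_{j\in I}$ by contexts ($I$ an ordered set), and let $\mathcal{G}$ be a presheaf of free $R$-semi-modules generated by local events, satisfying the three standing conditions recalled in the context. Let $\mathcal{U}$ be connected, $U_{j_0}\in\mathcal{U}$, and $c_{j_0}\in\mathcal{G}(U_{j_0})$. Then the obstruction $\gamma(c_{j_0})$ is trivial if and only if there is a compatible family $\{r_{j}\in\mathcal{G}(U_{j})\}_{U_{j}\in\mathcal{U}}$ such that $r_{j_0}=c_{j_0}$.
   Context: **Semi-rings.** A semi-ring $R$ has a commutative monoid $(R,+,0_R)$ and a monoid $(R,\cdot,1_R)$, with multiplication distributing over addition on both sides and $0_R$ annihilating. A semi-field is a commutative semi-ring with $0_R\ne 1_R$ in which each non-zero element has a multiplicative inverse (e.g. the Booleans $\mathbb{B}$ or $\mathbb{R}_{\ge 0}$). **Events.** $O$ is a finite outcome set, $X$ a set of measurements, and $\mathcal{U}=\{U_j\}_{j\in I}$ a covering of $X$ by maximal contexts (subsets of $X$), indexed by an ordered set $I$. For $V\subseteq X$, $\mathcal{E}(V)=O^V$ (so $O^\emptyset$ is a singleton), with restriction maps $s\mapsto s|_W$ for $W\subseteq V$. The local events form a sub-presheaf $\mathcal{L}$ of $\mathcal{E}$, defined on subsets of contexts: $\mathcal{L}(V)\subseteq O^V$. **The presheaf $\mathcal{G}$.** $\mathcal{G}(V)$ is the free $R$-semi-module with basis $\{[s]: s\in\mathcal{L}(V)\}$, and its restriction maps $r\mapsto r|_W$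 are the $R$-linear extensions of $[s]\mapsto[s|_W]$. Standing conditions: 1. $\mathcal{L}(U)\neq\emptyset$ (so $\mathcal{G}(U)$ is non-trivial) for every $U\in\mathcal{U}$. 2. $\mathcal{G}$ is flasque beneath the cover: the restriction $\mathcal{G}(U')\to\mathcal{G}(U)$ is surjective whenever $U\subseteq U'\subseteq V$ with $V\in\mathcal{U}$. 3. Every compatible family consisting of one basis element $[s_j]$, $s_j\in\mathcal{L}(U_j)$, for each context is induced by a unique global section $s\in O^X$, $s|_{U_j}=s_j$. A compatible family is a family $\{r_j\in\mathcal{G}(U_j)\}_{j\in I}$ with $r_j|_{U_j\cap U_k}=r_k|_{U_j\cap U_k}$ for all $j,k$. **Nerve and cochains.** The nerve has as $q$-simplices the tuples $\sigma=(U_{j_0},\dots,U_{j_q})$, $j_0<\dots<j_q$, with $|\sigma|=\bigcap_k U_{j_k}\neq\emptyset$. $\mathcal{U}$ is connected if the nerve is connected. Put $C^q(\mathcal{U},\mathcal{G})=\prod_\sigma\mathcal{G}(|\sigma|)$ over the $q$-simplices. The maps $d^0_+,d^0_-:C^0\to C^1$ are, for a $1$-simplex $(U_j,U_k)$ with $j<k$, $$d^0_+(c)(U_j,U_k)=c_k|_{U_j\cap U_k},\qquad d^0_-(c)(U_j,U_k)=c_j|_{U_j\cap U_k}.$$ **Difference cochains.** For $c\in C^0(\mathcal{U},\mathcal{G})$, consider cochains of operators $g=(g[\sigma])_\sigma$, with one operator $g[\sigma]:\mathcal{G}(|\sigma|)\to\mathcal{G}(|\sigma|)$ per $1$-simplex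 $\sigma$, such that $g[\sigma]\,d^0_+(c)(\sigma)=d^0_-(c)(\sigma)$. The difference cochain $[g,c]$ is the class of such $g$ under $[g,c]\sim[h,c]$ iff $g\,d^0_+(c)=h\,d^0_+(c)$. It is trivial if $[g,c]=[Id,c]$, where $Id$ is the cochain of identity operators, i.e. if $d^0_+(c)=d^0_-(c)$. **Obstruction.** Given $c_{j_0}\in\mathcal{G}(U_{j_0})$, condition 2 gives cochains $c=\{c_j\}_{j\in I}\in C^0(\mathcal{U},\mathcal{G})$ whose $j_0$ component is $c_{j_0}$ and with $c_{j_0}|_{U_{j_0}\cap U_j}=c_j|_{U_{j_0}\cap U_j}$ for all $j$. The obstruction $\gamma(c_{j_0})$ is the difference cochain $[g,c]$ of such a cochain $c$ (regarded as a difference cochain relative to $\mathcal{G}_{\bar U_{j_0}}$, the kernel of $\mathcal{G}\to\mathcal{G}|_{U_{j_0}}$, where $\mathcal{G}|_{U_{j_0}}(V)=\mathcal{G}(U_{j_0}\cap V)$). ''$\gamma(c_{j_0})$ is trivial'' means that there is a cochain $c$ of this kind whose difference cochain is trivial. *)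

(* Defs.v *)
From HB Require Import structures.
From mathcomp Require Import all_boot all_order all_algebra.
From mathcomp Require Import boolp classical_sets functions cardinality fsbigop.
From Stdlib Require Import Relation_Operators.

Set Implicit Arguments.
Unset Strict Implicit.
Unset Printing Implicit Defensive.

Import Order.TTheory GRing.Theory.
Local Open Scope classical_set_scope.
Local Open Scope ring_scope.

Definition semifield (R : comNzSemiRingType) : Prop :=
  forall x : R, x != 0 -> exists y : R, y * x = 1.

Section FreeSemiModule.
Variables (R : comNzSemiRingType) (K : choiceType).

(* The free semi-module on K consists of the finitely supported functions.  The
   MathComp instances of this construction require subtraction in R. *)
Record freemod := FreeMod {
  coef :> K -> R;
  finite_coef : finite_set [set k | coef k != 0] }.

Lemma freemodP (f g : freemod) : (forall k, f k = g k) <-> f = g.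
Proof.
split=> [|-> //]; case: f g => f ff [g fg] /= fg_eq.
have {}fg_eq : f = g by apply/funext.
by case: _ / fg_eq in fg *; congr FreeMod; exact: Prop_irrelevance.
Qed.

HB.instance Definition _ := gen_eqMixin freemod.
HB.instance Definition _ := gen_choiceMixin freemod.

Lemma fzero_subproof : finite_set [set k : K | (0 : R) != 0].
Proof.
by rewrite (_ : mkset _ = set0) //; apply/seteqP; split=> k //=; rewrite eqxx.
Qed.
Definition fzero := FreeMod fzero_subproof.

Lemma fadd_subproof (f g : freemod) : finite_set [set k | f k + g k != 0].
Proof.
apply: (@sub_finite_set _ _ ([set k | f k != 0] `|` [set k | g k != 0])).
  move=> k /= fgk; have [fk|fk] := eqVneq (f k) 0; last by left.
  by right; move: fgk; rewrite fk add0r.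
by rewrite finite_setU; split; exact: finite_coef.
Qed.
Definition fadd f g := FreeMod (fadd_subproof f g).

Lemma fscale_subproof (a : R) (f : freemod) :
  finite_set [set k | a * f k != 0].
Proof.
apply: sub_finite_set (finite_coef f) => k /=.
by apply: contraNneq => ->; rewrite mulr0.
Qed.
Definition fscale a f := FreeMod (fscale_subproof a f).

Lemma faddA : associative fadd.
Proof. by move=> f g h; apply/freemodP => k /=; rewrite addrA. Qed.
Lemma faddC : commutative fadd.
Proof. by move=> f g; apply/freemodP => k /=; rewrite addrC. Qed.
Lemma fadd0 : left_id fzero fadd.
Proof. by move=> f; apply/freemodP => k /=; rewrite add0r. Qed.

HB.instance Definition _ := GRing.isNmodule.Build freemod faddA faddC fadd0.

Lemma fscaleA a b f : fscale a (fscale b f) = fscale (a * b) f.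
Proof. by apply/freemodP => k /=; rewrite mulrA. Qed.
Lemma fscale0 f : fscale 0 f = 0.
Proof. by apply/freemodP => k /=; rewrite mul0r. Qed.
Lemma fscale1 : left_id 1 fscale.
Proof. by move=> f; apply/freemodP => k /=; rewrite mul1r. Qed.
Lemma fscaleDr : right_distributive fscale +%R.
Proof. by move=> a f g; apply/freemodP => k /=; rewrite mulrDr. Qed.
Lemma fscaleDl f : {morph fscale^~ f : a b / a + b}.
Proof. by move=> a b; apply/freemodP => k /=; rewrite mulrDl. Qed.

HB.instance Definition _ := GRing.Nmodule_isLSemiModule.Build R freemod
  fscaleA fscale0 fscale1 fscaleDr fscaleDl.

Lemma fbasis_subproof (k : K) : finite_set [set l | (k == l)%:R != 0 :> R].
Proof.
apply: sub_finite_set (finite_set1 k) => l /=.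
by have [->|_] := eqVneq k l => //; rewrite eqxx.
Qed.
Definition fbasis (k : K) : freemod := FreeMod (fbasis_subproof k).

End FreeSemiModule.

Definition free_map (R : comNzSemiRingType) (K K' : choiceType) (h : K -> K')
    (f : freemod R K) : freemod R K' :=
  \sum_(k \in [set k | f k != 0]) f k *: fbasis R (h k).

Section FreeMapTheory.
Variable R : comNzSemiRingType.

Variables (K K' : choiceType) (h : K -> K').

Lemma free_map_widen (A : set K) (f : freemod R K) : finite_set A ->
  [set k | f k != 0] `<=` A ->
  free_map h f = \sum_(k \in A) f k *: fbasis R (h k).
Proof.
move=> finA fA; apply: fsbig_widen => // k /= [_ /negP]; rewrite negbK => /eqP ->.
by rewrite scale0r.
Qed.

Lemma free_map_is_semilinear : semilinear (@free_map R K K' h).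
Proof.
split=> [a f|f g].
  rewrite (@free_map_widen [set k | f k != 0] (a *: f)); last 2 first.
  - exact: finite_coef.
  - by move=> k /=; apply: contraNneq => ->; rewrite mulr0.
  rewrite /free_map !fsbig_finite /=; try exact: finite_coef.
  rewrite (big_morph _ (scalerDr a) (scaler0 _ a)).
  by apply: eq_bigr => k _; rewrite scalerA.
pose A := [set k | f k != 0] `|` [set k | g k != 0].
have finA : finite_set A by rewrite finite_setU; split; exact: finite_coef.
have fA : [set k | f k != 0] `<=` A by move=> k; left.
have gA : [set k | g k != 0] `<=` A by move=> k; right.
have fgA : [set k | (f + g) k != 0] `<=` A.
  move=> k /= fgk; have [fk|fk] := eqVneq (f k) 0; last by left.
  by right; move: fgk; rewrite /= fk add0r.
rewrite (free_map_widen finA fA) (free_map_widen finA gA).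
rewrite (free_map_widen finA fgA).
rewrite !fsbig_finite //= -big_split /=.
by apply: eq_bigr => k _; rewrite -scalerDl.
Qed.

HB.instance Definition _ :=
  GRing.isSemilinear.Build R (freemod R K) (freemod R K') *:%R
    (@free_map R K K' h) free_map_is_semilinear.

Lemma free_map_basis k : free_map h (fbasis R k) = fbasis R (h k).
Proof.
rewrite (@free_map_widen [set k]) //; last first.
  by move=> l /=; have [->|_] := eqVneq k l => //; rewrite eqxx.
by rewrite fsbig_set1 /= eqxx scale1r.
Qed.

End FreeMapTheory.

Lemma free_map_comp (R : comNzSemiRingType) (K1 K2 K3 : choiceType)
    (h : K1 -> K2) (g : K2 -> K3) (f : freemod R K1) :
  free_map g (free_map h f) = free_map (g \o h) f.
Proof.
rewrite {2 3}/free_map !fsbig_finite; try exact: finite_coef.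
rewrite linear_sum /=.
by apply: eq_bigr => k _; rewrite linearZ /= free_map_basis.
Qed.

(* Local events are only given on the subsets of contexts, with no total
   extension to arbitrary sets of measurements. *)
Record under (X I : Type) (U : I -> set X) := Under {
  uset :> set X;
  underP : exists j, uset `<=` U j }.

Definition inclusion (X : Type) (V W : set X) (WV : W `<=` V) (x : W) : V :=
  SigSub (mem_set (WV _ (set_mem (valP x)))).

Definition restrict (X : Type) (O : finType) (V W : set X) (WV : W `<=` V) (s : V -> O) :
  W -> O := s \o inclusion WV.

Record event_presheaf (X : Type) (O : finType) (I : Type) (U : I -> set X) := EventPresheaf {
  events :> forall V : under U, set (V -> O);
  events_restrict : forall (V W : under U) (WV : W `<=` V) (s : V -> O),
    @events V s -> @events W (restrict WV s) }.
Arguments events {X O I U} _ V.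

Section Presheaf.
Variables (R : comNzSemiRingType) (X : Type) (O : finType).
Variables (I : Type) (U : I -> set X).
Variable L : event_presheaf O U.

Lemma context_subproof j : exists k, U j `<=` U k.
Proof. by exists j. Qed.
Definition context j : under U := Under (context_subproof j).

Lemma overlap_subproof j k : exists l, U j `&` U k `<=` U l.
Proof. by exists j; exact: subIsetl. Qed.
Definition overlap j k : under U := Under (overlap_subproof j k).

Lemma overlap_subl j k : overlap j k `<=` context j.
Proof. exact: subIsetl. Qed.
Lemma overlap_subr j k : overlap j k `<=` context k.
Proof. exact: subIsetr. Qed.

Definition event_restr (V W : under U) (WV : W `<=` V) (s : L V) : L W :=
  SigSub (mem_set (events_restrict WV (set_mem (valP s)))).

Definition G (V : under U) := freemod R (L V).

Definition G_restr (V W : under U) (WV : W `<=` V) : G V -> G W :=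
  free_map (event_restr WV).

Lemma G_restr_comp (V W Z : under U) (WV : W `<=` V) (ZW : Z `<=` W)
    (ZV : Z `<=` V) (r : G V) : G_restr ZW (G_restr WV r) = G_restr ZV r.
Proof.
rewrite /G_restr free_map_comp; congr free_map; apply/funext => s.
by apply/val_inj/funext => x /=; congr (val s _); exact/val_inj.
Qed.

Definition nonempty_events : Prop := forall j, L (context j) !=set0.

Definition flasque_beneath_cover : Prop :=
  forall (V W : under U) (WV : W `<=` V), set_surj setT setT (G_restr WV).

(* Maximality of the contexts makes every U j a vertex of the nerve as soon as
   X is inhabited, so that 0-cochains are the families indexed by I. *)
Definition C0 := forall j, G (context j).

Definition compatible (r : C0) : Prop :=
  forall j k, G_restr (@overlap_subl j k) (r j) = G_restr (@overlap_subr j k) (r k).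

Definition basis_families_glue : Prop :=
  forall s : (forall j, L (context j)), compatible (fun j => fbasis R (s j)) ->
  exists! t : X -> O, forall j, (fun x : context j => t (val x)) = val (s j).

End Presheaf.

Definition maximal_cover (X I : Type) (U : I -> set X) : Prop :=
  \bigcup_j U j = [set: X] /\ forall j k, U j `<=` U k -> U j = U k.

Section Obstruction.
Variables (R : comNzSemiRingType) (X : Type) (O : finType).
Variables (d : Order.disp_t) (I : orderType d) (U : I -> set X).
Variable L : event_presheaf O U.

Record edge := Edge {
  src : I;
  tgt : I;
  edge_lt : (src < tgt)%O;
  edge_neq0 : U src `&` U tgt !=set0 }.

Definition esupp (e : edge) : under U := overlap U (src e) (tgt e).

Definition nerve_connected : Prop :=
  forall j k, U j !=set0 -> U k !=set0 ->
  clos_refl_sym_trans I (fun a b => exists e : edge, src e = a /\ tgt e = b) j k.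

Definition C1 := forall e : edge, G R L (esupp e).

Definition d0p (c : C0 R L) : C1 :=
  fun e => G_restr (@overlap_subr _ _ U (src e) (tgt e)) (c (tgt e)).
Definition d0m (c : C0 R L) : C1 :=
  fun e => G_restr (@overlap_subl _ _ U (src e) (tgt e)) (c (src e)).

Definition op_cochain :=
  forall e : edge, {linear G R L (esupp e) -> G R L (esupp e)}.

Definition op_apply (g : op_cochain) (c : C1) : C1 := fun e => g e (c e).

Definition op_id : op_cochain := fun e => idfun.

Definition difference_op (c : C0 R L) (g : op_cochain) : Prop :=
  op_apply g (d0p c) = d0m c.

(* Equality of the classes [g, c] and [h, c]. *)
Definition difference_eq (c : C0 R L) (g h : op_cochain) : Prop :=
  op_apply g (d0p c) = op_apply h (d0p c).

Definition difference_trivial (c : C0 R L) : Prop :=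
  exists2 g, difference_op c g & difference_eq c g op_id.

Lemma difference_trivialP c : difference_trivial c <-> d0p c = d0m c.
Proof.
split=> [[g <- ->] //|cE]; exists op_id => //.
Qed.

Definition obstruction_cochain j0 (c0 : G R L (context U j0)) (c : C0 R L) : Prop :=
  c j0 = c0 /\
  forall j, G_restr (@overlap_subl _ _ U j0 j) c0 =
            G_restr (@overlap_subr _ _ U j0 j) (c j).

Lemma kernel_subproof j0 (V : under U) : exists k, U j0 `&` V `<=` U k.
Proof. by exists j0; exact: subIsetl. Qed.
Definition under_meet j0 V : under U := Under (kernel_subproof j0 V).

Lemma under_meet_sub j0 V : under_meet j0 V `<=` V.
Proof. exact: subIsetr. Qed.

(* Without subtraction, the kernel of the restriction of G to U j0 is the
   congruence of the pairs of sections with the same image. *)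
Definition kernel_rel j0 (V : under U) (r r' : G R L V) : Prop :=
  G_restr (@under_meet_sub j0 V) r = G_restr (@under_meet_sub j0 V) r'.

(* The difference cochain of an obstruction cochain is automatically relative
   to that kernel. *)
Lemma obstruction_cochain_relative j0 (c0 : G R L (context U j0)) (c : C0 R L) :
  obstruction_cochain c0 c -> forall e, kernel_rel j0 (d0p c e) (d0m c e).
Proof.
move=> [_ ext] e; set Z := under_meet j0 (esupp e).
have Z0 : Z `<=` context U j0 by move=> x [].
have key j (Zj : Z `<=` context U j) : G_restr Zj (c j) = G_restr Z0 c0.
  have Zov : Z `<=` overlap U j0 j by move=> x Zx; split; [exact: Z0|exact: Zj].
  by rewrite -(G_restr_comp (@overlap_subr _ _ U j0 j) Zov) -ext G_restr_comp.
have Zs : Z `<=` context U (src e) by move=> x [_ []].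
have Zt : Z `<=` context U (tgt e) by move=> x [_ []].
rewrite /kernel_rel /d0p /d0m (G_restr_comp _ _ Zt) (G_restr_comp _ _ Zs).
by rewrite !key.
Qed.

Definition obstruction_trivial j0 (c0 : G R L (context U j0)) : Prop :=
  exists2 c, obstruction_cochain c0 c & difference_trivial c.

End Obstruction.

(* Main.v *)
Require Import Defs.
From mathcomp Require Import all_boot all_order all_algebra.
From mathcomp Require Import boolp classical_sets.

(** A cochain [c] with [c j0 = c0] whose difference cochain is trivial satisfies
    [d0p c = d0m c], that is, its components agree on the overlap of every edge
    of the nerve.  Compatibility asks for more: agreement on the overlap of
    every pair of contexts, including the pairs with an empty overlap, which
    are not edges.  There the condition has content: a section over the empty
    set is a total weight.

    The empty overlaps are settled by the extension condition that [c]
    satisfies as an obstruction cochain.  Each component agrees with [c0] on its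
    overlap with [U j0], hence on every set contained in both contexts, and the
    empty set is contained in any two contexts.  So all the components have the
    total weight of [c0] ([obstruction_cochain_restr], [obstruction_cochain_empty]).

    Conversely, a compatible family that extends [c0] is an obstruction cochain
    for [c0], and its components agree on all overlaps, in particular on the
    edges.

    The passage between overlaps is functoriality of restriction
    ([agree_below]): two sections that agree on their overlap agree on every
    set contained in both contexts, whichever inclusion proofs are used. *)

Set Implicit Arguments.
Unset Strict Implicit.
Unset Printing Implicit Defensive.

Import Order.TTheory.
Local Open Scope classical_set_scope.

Section Restriction.
Variables (R : comNzSemiRingType) (X : Type) (O : finType).
Variables (I : Type) (U : I -> set X) (L : event_presheaf O U).

(** Stated for an arbitrary [Z], so that it also exchanges [overlap U j k] with
    [overlap U k j], which are distinct indices of the presheaf. *)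
Lemma agree_below j k (Z : under U) (Zj : Z `<=` context U j)
    (Zk : Z `<=` context U k) (a : G R L (context U j))
    (b : G R L (context U k)) :
  G_restr (@overlap_subl _ _ U j k) a = G_restr (@overlap_subr _ _ U j k) b ->
  G_restr Zj a = G_restr Zk b.
Proof.
move=> ab; have Zjk : Z `<=` overlap U j k.
  by move=> x Zx; split; [exact: Zj | exact: Zk].
by rewrite -(G_restr_comp (@overlap_subl _ _ U j k) Zjk) ab G_restr_comp.
Qed.

(** On the diagonal, compatibility compares the two projections of [overlap U j j]
    to [context U j], which differ as proofs. *)
Lemma G_restr_irrelevant j (Z : under U) (Zj Zj' : Z `<=` context U j)
    (a : G R L (context U j)) : G_restr Zj a = G_restr Zj' a.
Proof.
have ZZ : Z `<=` Z by [].
by rewrite -(G_restr_comp Zj' ZZ) G_restr_comp.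
Qed.

End Restriction.

Section Obstruction.
Variables (R : comNzSemiRingType) (X : Type) (O : finType).
Variables (d : Order.disp_t) (I : orderType d) (U : I -> set X).
Variable L : event_presheaf O U.

(** The extension condition transfers from overlaps with [U j0] to all smaller
    sets: such a restriction of [c] depends only on [c0], not on [j]. *)
Lemma obstruction_cochain_restr j0 (c0 : G R L (context U j0)) (c : C0 R L)
    (Z : under U) (Z0 : Z `<=` context U j0) j (Zj : Z `<=` context U j) :
  obstruction_cochain c0 c -> G_restr Zj (c j) = G_restr Z0 c0.
Proof. by move=> [_ ext]; apply/esym/agree_below. Qed.

Lemma obstruction_cochain_empty j0 (c0 : G R L (context U j0)) (c : C0 R L)
    (Z : under U) j k (Zj : Z `<=` context U j) (Zk : Z `<=` context U k) :
  obstruction_cochain c0 c -> Z = set0 :> set X ->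
  G_restr Zj (c j) = G_restr Zk (c k).
Proof.
move=> ext Z_eq0; have Z0 : Z `<=` context U j0 by rewrite Z_eq0.
by rewrite !(obstruction_cochain_restr Z0 _ ext).
Qed.

Lemma d0_eq_agree (c : C0 R L) j k (jk : (j < k)%O) :
  d0p c = d0m c -> U j `&` U k !=set0 ->
  G_restr (@overlap_subl _ _ U j k) (c j) =
  G_restr (@overlap_subr _ _ U j k) (c k).
Proof. by move=> dc jk0; rewrite -[LHS]/(d0m c (Edge jk jk0)) -dc. Qed.

Lemma compatible_d0_eq (c : C0 R L) : compatible c -> d0p c = d0m c.
Proof.
by move=> cc; apply: boolp.functional_extensionality_dep => e; apply/esym/cc.
Qed.

Lemma obstruction_cochain_compatible j0 (c0 : G R L (context U j0))
    (c : C0 R L) :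
  obstruction_cochain c0 c -> d0p c = d0m c -> compatible c.
Proof.
move=> ext dc j k.
have [jk0|jk0] := eqVneq (U j `&` U k) set0.
  exact: (obstruction_cochain_empty (Z := overlap U j k) _ _ ext jk0).
have {}jk0 : U j `&` U k !=set0 by apply/set0P.
have [jk|kj|jk] := ltgtP j k.
- exact: d0_eq_agree.
(* Edges are oriented upwards, so the edge here is (k, j), with support
   [overlap U k j]. *)
- by apply/esym/agree_below/(d0_eq_agree kj dc); rewrite setIC.
- by case: k / jk jk0 => _; exact: G_restr_irrelevant.
Qed.

End Obstruction.

Theorem theorem17 (R : comNzSemiRingType) (R_semifield : semifield R)
    (X : Type) (O : finType) (d : Order.disp_t) (I : orderType d)
    (U : I -> set X) (U_cover : maximal_cover U)
    (L : event_presheaf O U)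
    (L_nonempty : nonempty_events L)
    (G_flasque : flasque_beneath_cover R L)
    (G_glue : basis_families_glue R L)
    (U_connected : nerve_connected U)
    (j0 : I) (c0 : G R L (context U j0)) :
  obstruction_trivial c0 <->
  exists r : (forall j, G R L (context U j)), compatible r /\ r j0 = c0.
Proof.
split=> [[c ext /difference_trivialP dc]|[r [rc <-]]].
  by exists c; split; [exact: obstruction_cochain_compatible ext dc | case: ext].
exists r; first by split=> // j; exact: rc.
exact/difference_trivialP/compatible_d0_eq.
Qed.
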